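(* Let $(X,\Sigma,\lambda)$ be a positive measure space. A non-zero function $f\in L_1(X)$ is a right-symmetric point of $L_1(X)$ if and only if $\{x\in X:f(x)\ne0\}$ is an atom.
   Context: $\mathbb{K}$ is $\mathbb{R}$ or $\mathbb{C}$; $L_1(X)$ is the space of integrable $\mathbb{K}$-valued functions (modulo a.e. equality) with norm $\|f\|_1=\int_X|f|\,d\lambda$. A set $A\in\Sigma$ is an atom if $\lambda(A)>0$ and for every $B\in\Sigma$ with $B\subset A$ and $\lambda(B)>0$ one has $\lambda(A\setminus B)=0$. In a normed space $\mathbb{X}$ over $\mathbb{K}$, $x\perp_B y$ (Birkhoff-James orthogonality) means $\|x+\alpha y\|\ge\|x\|$ for all $\alpha\in\mathbb{K}$; $x\in\mathbb{X}$ is right-symmetric if $y\perp_B x$ implies $x\perp_B y$ for every $y\in\mathbb{X}$. *)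

(* Defs.v *)
From HB Require Import structures.
From mathcomp Require Import all_boot all_order all_algebra.
From mathcomp Require Import all_classical all_reals all_analysis.
From mathcomp Require Import generic_quotient ring_quotient.
From mathcomp Require Import measurable_realfun complex.

Set Implicit Arguments.
Unset Strict Implicit.
Unset Printing Implicit Defensive.
Import Order.TTheory GRing.Theory Num.Theory.
Import numFieldNormedType.Exports.
Local Open Scope classical_set_scope.
Local Open Scope ring_scope.

Inductive scalar_kind := RealScalars | ComplexScalars.

Definition scalars (R : realType) (k : scalar_kind) : numFieldType :=
  match k with RealScalars => R | ComplexScalars => R[i] end.

Section scalar_operations.
Context {R : realType}.

Definition of_real {k : scalar_kind} : R -> scalars R k :=
  match k with
  | RealScalars => fun a => a
  | ComplexScalars => fun a => (a%:C)%C
  end.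

(* The norm of a [numFieldType] takes values in that field; [modulus] is the
   same norm read in R (see [of_real_modulus]). *)
Definition modulus {k : scalar_kind} : scalars R k -> R :=
  match k with
  | RealScalars => fun z : R => `|z|
  | ComplexScalars => fun z : R[i] => ComplexField.Normc.normc z
  end.

Lemma of_real_modulus k (z : scalars R k) : of_real (modulus z) = `|z|.
Proof. by case: k z. Qed.

Lemma of_realD k (a b : R) :
  of_real (a + b) = of_real a + of_real b :> scalars R k.
Proof. by case: k => //=; rewrite rmorphD. Qed.

Lemma of_realM k (a b : R) :
  of_real (a * b) = of_real a * of_real b :> scalars R k.
Proof. by case: k => //=; rewrite rmorphM. Qed.

Lemma ler_of_real k (a b : R) :
  (of_real a <= of_real b :> scalars R k) = (a <= b).
Proof. by case: k => //=; rewrite lecR. Qed.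

Lemma of_real0 k : of_real 0 = 0 :> scalars R k.
Proof. by case: k. Qed.

Lemma of_real_inj k : injective (@of_real k).
Proof. by move=> a b /eqP; rewrite eq_le !ler_of_real -eq_le => /eqP. Qed.

Lemma modulus_ge0 k (z : scalars R k) : 0 <= modulus z.
Proof. by rewrite -(ler_of_real k) of_real0 of_real_modulus. Qed.

Lemma modulusD k (z w : scalars R k) : modulus (z + w) <= modulus z + modulus w.
Proof. by rewrite -(ler_of_real k) of_realD !of_real_modulus ler_normD. Qed.

Lemma modulusM k (z w : scalars R k) : modulus (z * w) = modulus z * modulus w.
Proof. by apply: (@of_real_inj k); rewrite of_realM !of_real_modulus normrM. Qed.

Lemma modulus_eq0 k (z : scalars R k) : (modulus z == 0) = (z == 0).
Proof.
by rewrite -[RHS]normr_eq0 -of_real_modulus -(inj_eq (@of_real_inj k)) of_real0.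
Qed.

End scalar_operations.

Section L1_functions.
Context {d : measure_display} {T : measurableType d} {R : realType}.
Variables (mu : {measure set T -> \bar R}) (k : scalar_kind).
Local Notation K := (scalars R k).

Definition scalar_integrable : (T -> K) -> bool :=
  match k with
  | RealScalars => fun f : T -> R => mu.-integrable setT (EFin \o f)
  | ComplexScalars => fun f : T -> R[i] =>
      mu.-integrable setT (EFin \o (fun x => complex.Re (f x))) &&
      mu.-integrable setT (EFin \o (fun x => complex.Im (f x)))
  end.

Record L1fun := MkL1fun {
  L1val :> T -> K ;
  L1valP : scalar_integrable L1val }.

HB.instance Definition _ := [isSub for L1val].
HB.instance Definition _ := [Choice of L1fun by <:].

End L1_functions.

Section L1_lmodule.
Context {d : measure_display} {T : measurableType d} {R : realType}.
Variables (mu : {measure set T -> \bar R}) (k : scalar_kind).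
Local Notation K := (scalars R k).

Lemma integrable_EFinD (f g : T -> R) :
  mu.-integrable setT (EFin \o f) -> mu.-integrable setT (EFin \o g) ->
  mu.-integrable setT (EFin \o (fun x => f x + g x)).
Proof. by move=> fi gi; exact: (integrableD measurableT fi gi). Qed.

Lemma integrable_EFinZ (a : R) (f : T -> R) :
  mu.-integrable setT (EFin \o f) ->
  mu.-integrable setT (EFin \o (fun x => a * f x)).
Proof. by move=> fi; exact: (integrableZl measurableT a fi). Qed.

Lemma scalar_integrable_submod : submod_closed (@scalar_integrable d T R mu k).
Proof.
rewrite /scalar_integrable; split.
  case: k; first exact: integrable0.
  by rewrite -topredE /=; apply/andP; split; exact: integrable0.
case: k => /= [a f g|a f g]; rewrite -!topredE /=.
  by move=> fi gi; apply: integrable_EFinD => //; exact: integrable_EFinZ.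
move=> /andP[rf imf] /andP[rg ig]; apply/andP; split.
  rewrite (_ : (fun x => _) = (fun x =>
    (complex.Re a * complex.Re (f x) + (- complex.Im a) * complex.Im (f x))
      + complex.Re (g x))).
    by do 2?[apply: integrable_EFinD => //]; exact: integrable_EFinZ.
  apply/funext => x; rewrite !fctE; case: a (f x) (g x) => [a1 a2] [f1 f2] [g1 g2].
  by rewrite /= mulNr.
rewrite (_ : (fun x => _) = (fun x =>
    (complex.Re a * complex.Im (f x) + complex.Im a * complex.Re (f x))
      + complex.Im (g x))).
  by do 2?[apply: integrable_EFinD => //]; exact: integrable_EFinZ.
by apply/funext => x; rewrite !fctE; case: a (f x) (g x) => [a1 a2] [f1 f2] [g1 g2].
Qed.

HB.instance Definition _ := GRing.isSubmodClosed.Build K (T -> K)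
  (@scalar_integrable d T R mu k) scalar_integrable_submod.
HB.instance Definition _ :=
  [SubChoice_isSubLmodule of L1fun mu k by <:].

Lemma L1fun_addE (f g : L1fun mu k) x : (f + g) x = f x + g x.
Proof. by []. Qed.

Lemma L1fun_oppE (f : L1fun mu k) x : (- f) x = - f x.
Proof. by []. Qed.

Lemma L1fun_scaleE (a : K) (f : L1fun mu k) x : (a *: f) x = a * f x.
Proof. by []. Qed.

Lemma integrable_modulus (f : L1fun mu k) :
  mu.-integrable setT (EFin \o (fun x => modulus (f x))).
Proof.
case: f => f; rewrite /scalar_integrable /modulus /=.
case: k f => /= f; first exact: integrable_norm.
move=> /andP[rf imf].
have mrf : measurable_fun [set: T] (fun x => complex.Re (f x)).
  by apply/measurable_EFinP; exact: measurable_int rf.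
have mif : measurable_fun [set: T] (fun x => complex.Im (f x)).
  by apply/measurable_EFinP; exact: measurable_int imf.
have nE x : ComplexField.Normc.normc (f x) =
    Num.sqrt (complex.Re (f x) ^+ 2 + complex.Im (f x) ^+ 2).
  by case: (f x).
apply: (@le_integrable _ _ _ _ _ measurableT _
  (EFin \o (fun x => `|complex.Re (f x)| + `|complex.Im (f x)|))).
- apply/measurable_EFinP; under eq_fun do rewrite nE.
  apply: measurableT_comp; first exact: (continuous_measurable_fun (@sqrt_continuous R)).
  by apply: measurable_funD; exact: measurable_funX.
- move=> x _; rewrite /= lee_fin nE ger0_norm ?sqrtr_ge0//.
  rewrite [leRHS]ger0_norm ?addr_ge0//.
  rewrite -[leRHS](@ger0_norm R) ?addr_ge0// -sqrtr_sqr ler_wsqrtr//.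
  by rewrite sqrrD !real_normK ?num_real// lerD2r lerDl mulrn_wge0// mulr_ge0.
- by apply: integrable_EFinD; exact: integrable_norm.
Qed.

Definition null_L1fun : {pred L1fun mu k} :=
  fun f => `[< \forall x \ae mu, f x = 0 >].

Lemma null_L1funP (f : L1fun mu k) :
  reflect (\forall x \ae mu, f x = 0) (f \in null_L1fun).
Proof. exact: asboolP. Qed.

Lemma null_L1fun_submod : submod_closed null_L1fun.
Proof.
split; first by apply/null_L1funP; exact: aeW.
move=> a f g /null_L1funP f0 /null_L1funP g0; apply/null_L1funP.
by apply: filterS2 f0 g0 => x fx gx; rewrite L1fun_addE L1fun_scaleE fx gx mulr0 addr0.
Qed.

HB.instance Definition _ := GRing.isSubmodClosed.Build K (L1fun mu k)
  null_L1fun null_L1fun_submod.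

End L1_lmodule.

Section L1_space.
Context {d : measure_display} {T : measurableType d} {R : realType}.
Variables (mu : {measure set T -> \bar R}) (k : scalar_kind).
Local Notation K := (scalars R k).
Local Open Scope quotient_scope.

Definition L1 : Type := Quotient.quot (@null_L1fun d T R mu k).
HB.instance Definition _ := Choice.on L1.
HB.instance Definition _ := EqQuotient.on L1.
HB.instance Definition _ := GRing.Zmodule.on L1.
HB.instance Definition _ := ZmodQuotient.on L1.

Definition toL1 (f : L1fun mu k) : L1 := \pi_L1 f.

Lemma toL1_eqP (f g : L1fun mu k) :
  toL1 f = toL1 g <-> \forall x \ae mu, f x = g x.
Proof.
rewrite /toL1; split.
  move=> /eqP; rewrite piE Quotient.equivE => /null_L1funP.
  by apply: filterS => x /eqP; rewrite L1fun_addE L1fun_oppE subr_eq0 => /eqP.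
move=> fg; apply/eqP; rewrite piE Quotient.equivE; apply/null_L1funP.
by apply: filterS fg => x fgx; rewrite L1fun_addE L1fun_oppE fgx subrr.
Qed.

Lemma reprL1 (F : L1) : toL1 (repr F) = F.
Proof. exact: reprK. Qed.

Lemma repr_toL1 (f : L1fun mu k) : \forall x \ae mu, repr (toL1 f) x = f x.
Proof. by apply/toL1_eqP; rewrite reprL1. Qed.

Lemma toL1D (f g : L1fun mu k) : toL1 (f + g) = toL1 f + toL1 g.
Proof. exact: raddfD. Qed.

Definition L1scale (a : K) (F : L1) : L1 := toL1 (a *: repr F).

Lemma L1scale_toL1 (a : K) (f : L1fun mu k) :
  L1scale a (toL1 f) = toL1 (a *: f).
Proof.
by apply/toL1_eqP; apply: filterS (repr_toL1 f) => x fx; rewrite !L1fun_scaleE fx.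
Qed.

Lemma L1scaleA (a b : K) (F : L1) : L1scale a (L1scale b F) = L1scale (a * b) F.
Proof. by rewrite -[F]reprL1 !L1scale_toL1 scalerA. Qed.

Lemma L1scale1 : left_id 1 L1scale.
Proof. by move=> F; rewrite -[F]reprL1 L1scale_toL1 scale1r. Qed.

Lemma L1scaleDr : right_distributive L1scale +%R.
Proof.
move=> a F G; rewrite -[F]reprL1 -[G]reprL1.
by rewrite -toL1D !L1scale_toL1 -toL1D scalerDr.
Qed.

Lemma L1scaleDl (F : L1) : {morph L1scale^~ F : a b / a + b}.
Proof.
by move=> a b; rewrite /= -[F]reprL1 !L1scale_toL1 -toL1D scalerDl.
Qed.

HB.instance Definition _ := GRing.Zmodule_isLmodule.Build K L1
  L1scaleA L1scale1 L1scaleDr L1scaleDl.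

Lemma toL1Z (a : K) (f : L1fun mu k) : toL1 (a *: f) = a *: toL1 f.
Proof. exact/esym/L1scale_toL1. Qed.

(* K-valued, as required of the norm of a module over a [numFieldType]: it is
   the image in K of the real number \int |F|. *)
Definition L1norm (F : L1) : K := of_real (\int[mu]_x modulus (repr F x)).

Lemma L1norm_toL1 (f : L1fun mu k) :
  L1norm (toL1 f) = of_real (\int[mu]_x modulus (f x)).
Proof.
congr (of_real (fine _)); apply: ae_eq_integral => //.
- exact: measurable_int (integrable_modulus (repr (toL1 f))).
- exact: measurable_int (integrable_modulus f).
- by apply: filterS (repr_toL1 f) => x -> _.
Qed.

Lemma L1normD (F G : L1) : L1norm (F + G) <= L1norm F + L1norm G.
Proof.
rewrite -[F]reprL1 -[G]reprL1 -toL1D !L1norm_toL1 -of_realD ler_of_real.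
rewrite -RintegralD//; try exact: integrable_modulus.
apply: le_Rintegral => //; first exact: integrable_modulus.
- by apply: integrable_EFinD; exact: integrable_modulus.
- by move=> x _; exact: modulusD.
Qed.

Lemma L1normZ (a : K) (F : L1) : L1norm (a *: F) = `|a| * L1norm F.
Proof.
rewrite -[F]reprL1 -toL1Z !L1norm_toL1 -of_real_modulus -of_realM.
rewrite -RintegralZl//; last exact: integrable_modulus.
by congr (of_real _); apply: eq_Rintegral => x _; rewrite L1fun_scaleE modulusM.
Qed.

Lemma L1norm_eq0 (F : L1) : L1norm F = 0 -> F = 0.
Proof.
rewrite -[F]reprL1 L1norm_toL1 -(of_real0 k) => /of_real_inj h.
have im := integrable_modulus (repr F).
have -> : (0 : L1) = toL1 0 by rewrite /toL1 raddf0.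
apply/toL1_eqP.
have : (\int[mu]_x `|(modulus (repr F x))%:E|)%E = 0%E.
  under eq_integral do rewrite gee0_abs ?lee_fin ?modulus_ge0//.
  by rewrite -[LHS](fineK (integrable_fin_num measurableT im)); congr EFin.
move=> /(ae_eq_integral_abs _ measurableT (measurable_int _ im)).
apply: filterS => x /(_ I) [] /eqP; rewrite modulus_eq0 => /eqP ->.
by [].
Qed.

HB.instance Definition _ := @Lmodule_isNormed.Build K L1 L1norm
  L1normD L1normZ L1norm_eq0.

Lemma normr_toL1 (f : L1fun mu k) :
  `|toL1 f| = of_real (\int[mu]_x modulus (f x)).
Proof. exact: L1norm_toL1. Qed.

End L1_space.

(* For K = R[i] the order on K compares complex numbers with equal imaginary
   parts; both sides below are real, so this is the order of the reals. *)
Definition BJ_orthogonal (K : numFieldType) (V : normedModType K) (x y : V) :=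
  forall a : K, `|x| <= `|x + a *: y|.

Definition right_symmetric (K : numFieldType) (V : normedModType K) (x : V) :=
  forall y : V, BJ_orthogonal y x -> BJ_orthogonal x y.

Definition measure_atom (d : measure_display) (T : measurableType d)
    (R : realType) (mu : {measure set T -> \bar R}) (A : set T) :=
  [/\ measurable A, (0 < mu A)%E &
      forall B, measurable B -> B `<=` A -> (0 < mu B)%E -> mu (A `\` B) = 0%E].

(* Main.v *)
Require Import Defs.
From mathcomp Require Import all_boot all_order all_algebra.
From mathcomp Require Import all_classical all_reals all_analysis.
From mathcomp Require Import measurable_realfun complex.
Import Order.TTheory GRing.Theory Num.Theory.
Import numFieldNormedType.Exports.
Local Open Scope classical_set_scope.
Local Open Scope ring_scope.

(** Write [mass f D] for the integral of [|f|] over [D], and [A] for the support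
    of [f]. Both implications come down to one choice of scalar in the inequality
    defining Birkhoff-James orthogonality, tested on a decomposition of the space
    into a set and its complement.

    Suppose [A] is an atom. A real integrable function has, up to a null set, a
    constant sign on [A], so it vanishes a.e. on [A] as soon as its integral over
    [A] does ([measure_atom_Rintegral_eq0]). Integration over [A] is thus an
    injective functional on the restrictions to [A], which therefore span a line:
    every [g] satisfies [g = - a f] a.e. on [A] for some scalar [a]
    ([measure_atom_proportional]). If [g] is orthogonal to [f], this [a] gives
    [mass g X <= mass (g + a f) X = mass g (~` A)], so [g] vanishes a.e. on [A].
    Then [f] and [g] have disjoint supports and [f] is orthogonal to [g].

    Conversely, let [f] be right-symmetric. If [B] carries at most half of the
    mass of [f], then [g := f 1_B] is orthogonal to [f], since
    [|1 + a| mass f B + |a| mass f (~` B) >= (|1 + a| + |a|) mass f B >= mass f B].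
    Hence [f] is orthogonal to [g], and [mass f X <= mass (f - g) X = mass f (~` B)]
    forces [mass f B = 0] ([right_symmetric_light_part]). For every measurable [B]
    either [B] or its complement is light in this sense, so [f] vanishes a.e. on
    one of the two. For [B] included in [A] this makes [B] or [A `\` B] a null set,
    and [A] is not null because [f] is not zero: [A] is an atom. *)

(** * Real integrals over an atom *)

Section real_integrals.
Context {d : measure_display} {T : measurableType d} {R : realType}.
Variable mu : {measure set T -> \bar R}.
Implicit Types (D : set T) (u v : T -> R).

Lemma null_set_aeP D : measurable D ->
  mu D = 0%E <-> \forall x \ae mu, ~ D x.
Proof.
move=> mD; split => [D0|aeD].
  by exists D; split => // x /contrapT.
apply/negligibleP => //; apply: negligibleS aeD => x Dx; exact.
Qed.

Lemma eq_Rintegral_ae D u v : measurable D ->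
  mu.-integrable D (EFin \o u) -> mu.-integrable D (EFin \o v) ->
  (\forall x \ae mu, D x -> u x = v x) ->
  \int[mu]_(x in D) u x = \int[mu]_(x in D) v x.
Proof.
move=> mD iu iv uv; congr fine; apply: ae_eq_integral => //.
- exact: measurable_int iu.
- exact: measurable_int iv.
- by apply: filterS uv => x uvx Dx; rewrite uvx.
Qed.

Lemma ae_eq0_of_Rintegral_norm D u : measurable D ->
  mu.-integrable D (EFin \o u) -> \int[mu]_(x in D) `|u x| = 0 ->
  \forall x \ae mu, D x -> u x = 0.
Proof.
move=> mD iu u0.
have : (\int[mu]_(x in D) `|(EFin \o u) x| = 0)%E.
  have := fineK (integrable_fin_num mD (integrable_norm iu)).
  by rewrite [X in X%:E = _]u0 => <-.
move=> /(ae_eq_integral_abs _ mD (measurable_int _ iu)).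
by apply: filterS => x ux /ux [].
Qed.

Lemma ae_eq0_of_Rintegral_ge0 D u : measurable D ->
  mu.-integrable D (EFin \o u) -> (\forall x \ae mu, D x -> 0 <= u x) ->
  \int[mu]_(x in D) u x = 0 -> \forall x \ae mu, D x -> u x = 0.
Proof.
move=> mD iu u0 Iu; apply: ae_eq0_of_Rintegral_norm => //.
rewrite -Iu; apply: eq_Rintegral_ae => //; first exact: integrable_norm.
by apply: filterS u0 => x u0 /u0 ?; rewrite ger0_norm.
Qed.

(** An atom cannot be cut into two parts of positive measure, so on it every
    measurable property is a.e. true or a.e. false. *)
Lemma measure_atom_dichotomy (A P : set T) : measure_atom mu A ->
  measurable P -> (\forall x \ae mu, A x -> P x) \/
                  (\forall x \ae mu, A x -> ~ P x).
Proof.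
move=> [mA A0 atomA] mP; have mAP : measurable (A `&` P) by exact: measurableI.
have [/(null_set_aeP _ mAP) AP0|] := eqVneq (mu (A `&` P)) 0%E.
  by right; apply: filterS AP0 => x + Ax Px; apply.
rewrite -measure_gt0 => /(atomA _ mAP (@subIsetl _ _ _)).
move=> /null_set_aeP-/(_ (measurableD mA mAP)) AP0; left.
by apply: filterS AP0 => x xAP Ax; apply: contrapT => Px; apply: xAP; split => // -[].
Qed.

(** By the dichotomy applied to [0 < u], either [u] or [- u] is a.e. nonnegative on
    the atom, and a nonnegative function of integral zero vanishes a.e. *)
Lemma measure_atom_Rintegral_eq0 (A : set T) u : measure_atom mu A ->
  mu.-integrable setT (EFin \o u) -> \int[mu]_(x in A) u x = 0 ->
  \forall x \ae mu, A x -> u x = 0.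
Proof.
move=> atomA iuT Iu; have [mA _ _] := atomA.
have iu : mu.-integrable A (EFin \o u) by exact: integrableS iuT.
have mP : measurable [set x | 0 < u x].
  have /measurable_EFinP meas_u := measurable_int _ iuT.
  have := meas_u measurableT _ (measurable_itv `]0, +oo[).
  rewrite setTI; congr measurable.
  by apply/seteqP; split => x /=; rewrite in_itv/= andbT.
have [u0|u0] := measure_atom_dichotomy _ _ atomA mP.
  apply: ae_eq0_of_Rintegral_ge0 => //.
  by apply: filterS u0 => x u0 /u0 /= /ltW.
have : \forall x \ae mu, A x -> - u x = 0.
  apply: ae_eq0_of_Rintegral_ge0 => //.
  - by have := integrableN iu.
  - by apply: filterS u0 => x u0 /u0 /= /negP; rewrite -leNgt oppr_ge0.
  - under eq_Rintegral do rewrite -mulN1r.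
    by rewrite RintegralZl// Iu mulr0.
by apply: filterS => x u00 /u00 /eqP; rewrite oppr_eq0 => /eqP.
Qed.

End real_integrals.

(** * Scalar functions on an atom are proportional *)

Section scalar_integrals.
Context {d : measure_display} {T : measurableType d} {R : realType}.
Variables (mu : {measure set T -> \bar R}) (k : scalar_kind).
Local Notation K := (scalars R k).
Implicit Types (f g : L1fun mu k) (D : set T).

Definition scalar_integral D : (T -> K) -> K :=
  match k with
  | RealScalars => fun f : T -> R => \int[mu]_(x in D) f x
  | ComplexScalars => fun f : T -> R[i] =>
      (\int[mu]_(x in D) complex.Re (f x) +i* \int[mu]_(x in D) complex.Im (f x))%C
  end.

Lemma scalar_integral_linear D f g (a : K) : measurable D ->
  scalar_integral D (fun x => g x + a * f x) =
  scalar_integral D g + a * scalar_integral D f.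
Proof.
move=> mD; case: f g => f + [g].
rewrite /scalar_integral /scalar_integrable /=; case: k f g a => /= f g a.
  move=> /(integrableS measurableT mD (@subsetT _ _)) fi.
  move=> /(integrableS measurableT mD (@subsetT _ _)) gi.
  by rewrite RintegralD// ?RintegralZl//; exact: (integrableZl mD a fi).
move=> /andP[/(integrableS measurableT mD (@subsetT _ _)) rf].
move=> /(integrableS measurableT mD (@subsetT _ _)) jf.
move=> /andP[/(integrableS measurableT mD (@subsetT _ _)) rg].
move=> /(integrableS measurableT mD (@subsetT _ _)) jg.
have iD u v : mu.-integrable D (EFin \o u) -> mu.-integrable D (EFin \o v) ->
    mu.-integrable D (EFin \o (fun x => u x + v x)).
  by move=> iu iv; exact: (integrableD mD iu iv).
have iZ (c : R) u : mu.-integrable D (EFin \o u) ->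
    mu.-integrable D (EFin \o (fun x => c * u x)).
  by move=> iu; exact: (integrableZl mD c iu).
case: a => a b.
have -> : (fun x => complex.Re (g x + (a +i* b)%C * f x)) =
    (fun x => complex.Re (g x) +
      (a * complex.Re (f x) + (- b) * complex.Im (f x))).
  by apply/funext => x; case: (f x) (g x) => [? ?] [? ?] /=; rewrite mulNr.
have -> : (fun x => complex.Im (g x + (a +i* b)%C * f x)) =
    (fun x => complex.Im (g x) +
      (a * complex.Im (f x) + b * complex.Re (f x))).
  by apply/funext => x; case: (f x) (g x) => [? ?] [? ?].
rewrite !RintegralD ?RintegralZl//; try by do ?[exact: iZ|apply: iD].
by apply/eqP; rewrite eq_complex /= mulNr !eqxx.
Qed.

Lemma measure_atom_scalar_integral_eq0 (A : set T) f : measure_atom mu A ->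
  scalar_integral A f = 0 -> \forall x \ae mu, A x -> f x = 0.
Proof.
move=> atomA; case: f => f.
rewrite /scalar_integral /scalar_integrable /=; case: k f => /= f.
  by move=> fi; exact: measure_atom_Rintegral_eq0.
move=> /andP[rf jf] [] /(measure_atom_Rintegral_eq0 _ _ _ atomA rf) r0.
move=> /(measure_atom_Rintegral_eq0 _ _ _ atomA jf) j0.
apply: filterS2 r0 j0 => x + + Ax => /(_ Ax) + /(_ Ax).
by case: (f x) => ? ? /= -> ->.
Qed.

(** The integral over the atom is linear and, on restrictions to the atom, injective
    with values in [K]; hence these restrictions form a space of dimension at most
    one. *)
Lemma measure_atom_proportional (A : set T) f g : measure_atom mu A ->
  ~ (\forall x \ae mu, A x -> f x = 0) ->
  exists a : K, \forall x \ae mu, A x -> g x + a * f x = 0.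
Proof.
move=> atomA fN0; have [mA _ _] := atomA.
have If : scalar_integral A f != 0.
  by apply/eqP => /(measure_atom_scalar_integral_eq0 _ _ atomA).
exists (- (scalar_integral A g / scalar_integral A f)).
apply: (measure_atom_scalar_integral_eq0 _ (g + _ *: f) atomA).
by rewrite scalar_integral_linear// mulNr divfK// subrr.
Qed.

End scalar_integrals.

(** * The norm over a measurable set *)

Section mass.
Context {d : measure_display} {T : measurableType d} {R : realType}.
Variables (mu : {measure set T -> \bar R}) (k : scalar_kind).
Local Notation K := (scalars R k).
Implicit Types (f g : L1fun mu k) (D : set T).

Definition mass (f : T -> K) D : R := \int[mu]_(x in D) modulus (f x).

Lemma mass_ge0 (f : T -> K) D : 0 <= mass f D.
Proof. by apply: Rintegral_ge0 => x _; exact: modulus_ge0. Qed.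

Lemma integrable_modulus_in f D : measurable D ->
  mu.-integrable D (EFin \o (fun x => modulus (f x))).
Proof. by move=> mD; apply: integrableS (integrable_modulus f). Qed.

Lemma mass_eq0 f D : measurable D -> mass f D = 0 ->
  \forall x \ae mu, D x -> f x = 0.
Proof.
move=> mD f0; have : \forall x \ae mu, D x -> modulus (f x) = 0.
  apply: ae_eq0_of_Rintegral_ge0 => //; first exact: integrable_modulus_in.
  by apply: aeW => x _; exact: modulus_ge0.
by apply: filterS => x + Dx => /(_ Dx) /eqP; rewrite modulus_eq0 => /eqP.
Qed.

Lemma eq_mass f g D : measurable D -> (\forall x \ae mu, D x -> f x = g x) ->
  mass f D = mass g D.
Proof.
move=> mD fg; apply: eq_Rintegral_ae; rewrite //; try exact: integrable_modulus_in.
by apply: filterS fg => x fg /fg ->.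
Qed.

Lemma mass_ae0 f D : measurable D -> (\forall x \ae mu, D x -> f x = 0) ->
  mass f D = 0.
Proof.
move=> mD f0; rewrite (@eq_mass f 0)//.
rewrite /mass (@eq_Rintegral _ _ _ _ _ (cst 0)); last first.
  by move=> x _; apply/eqP; rewrite modulus_eq0.
by rewrite Rintegral_cst// mul0r.
Qed.

Lemma mass_scale f D (a : K) : measurable D ->
  mass (a *: f) D = modulus a * mass f D.
Proof.
move=> mD; rewrite /mass -RintegralZl//; last exact: integrable_modulus_in.
by apply: eq_Rintegral => x _; rewrite L1fun_scaleE modulusM.
Qed.

Lemma mass_split f D : measurable D -> mass f setT = mass f D + mass f (~` D).
Proof.
move=> mD; rewrite -(setUv D) /mass Rintegral_setU//; first exact: measurableC.
  by rewrite setUv; exact: integrable_modulus.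
exact/disj_setPCl.
Qed.

Lemma mass_gt0 f D : measurable D -> (0 < mu D)%E ->
  (forall x, D x -> f x != 0) -> 0 < mass f D.
Proof.
move=> mD D0 fN0; rewrite lt_neqAle mass_ge0 andbT eq_sym.
apply/eqP => /(mass_eq0 _ _ mD) f0; move: D0; rewrite lt_neqAle eq_sym.
case/andP => /eqP + _; apply; apply/null_set_aeP => //.
by apply: filterS f0 => x f0 Dx; move: (fN0 x Dx); rewrite f0// eqxx.
Qed.

Lemma BJ_orthogonal_massP f g : BJ_orthogonal (toL1 g) (toL1 f) <->
  forall a : K, mass g setT <= mass (g + a *: f) setT.
Proof.
by split => h a; have := h a; rewrite -toL1Z -toL1D !normr_toL1 ler_of_real.
Qed.

Lemma measurable_support f : measurable [set x | f x != 0].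
Proof.
have mm : measurable_fun setT (fun x => modulus (f x)).
  by apply/measurable_EFinP; exact: measurable_int (integrable_modulus f).
have := mm measurableT (~` [set 0]) (measurableC (measurable_set1 _)).
rewrite setTI; congr measurable; apply/seteqP; split => x /=.
  by move=> /eqP; rewrite modulus_eq0.
by rewrite -modulus_eq0 => /eqP.
Qed.

Lemma scalar_integrable_restrict f D : measurable D ->
  scalar_integrable mu (fun x => if x \in D then f x else 0).
Proof.
move=> mD; have ir u : mu.-integrable setT (EFin \o u) ->
    mu.-integrable setT (EFin \o (fun x => if x \in D then u x else 0)).
  move=> iu.
  have /(integrable_mkcond _ mD) := integrableS measurableT mD (@subsetT _ _) iu.
  congr (mu.-integrable _ _); apply/funext => x /=.
  by rewrite patchE; case: ifP.
case: f => f; rewrite /scalar_integrable /=; case: k f => /= f.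
  exact: ir.
move=> /andP[rf jf]; apply/andP; split.
  have := ir _ rf.
  by congr (mu.-integrable _ _); apply/funext => x /=; case: ifP.
have := ir _ jf.
by congr (mu.-integrable _ _); apply/funext => x /=; case: ifP.
Qed.

Definition L1restrict f D (mD : measurable D) : L1fun mu k :=
  MkL1fun (scalar_integrable_restrict f D mD).

(** * The two implications *)

Lemma measure_atom_right_symmetric f :
  measure_atom mu [set x | f x != 0] -> right_symmetric (toL1 f).
Proof.
set A := [set x | f x != 0] => atomA G; rewrite -[G]reprL1.
set g := repr G; have [mA A0 _] := atomA; have mCA := measurableC mA.
have fCA x : (~` A) x -> f x = 0 by move=> /negP; rewrite negbK => /eqP.
move=> /BJ_orthogonal_massP gf.
have fN0 : ~ (\forall x \ae mu, A x -> f x = 0).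
  move=> f0; have := mass_gt0 f A mA A0 (fun x => id).
  by rewrite mass_ae0// ltxx.
have [a ga] := measure_atom_proportional mu k A f g atomA fN0.
(* With this [a] the sum vanishes on [A] and is [g] elsewhere, so orthogonality
   leaves no room for the part of the norm of [g] carried by [A]. *)
have gA : \forall x \ae mu, A x -> g x = 0.
  apply: mass_eq0 => //; apply/eqP; rewrite eq_le mass_ge0 andbT.
  have := gf a; rewrite !(mass_split _ _ mA) (mass_ae0 (g + a *: f))// add0r.
  rewrite (eq_mass (g + a *: f) g (~` A))// ?gerDr//.
  by apply: aeW => x /fCA fx; rewrite L1fun_addE L1fun_scaleE fx mulr0 addr0.
apply/BJ_orthogonal_massP => b.
rewrite !(mass_split _ _ mA) (mass_ae0 f (~` A))//; last exact: aeW.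
rewrite addr0 (eq_mass (f + b *: g) f A)// ?lerDl ?mass_ge0//.
by apply: filterS gA => x gx /gx gx0; rewrite L1fun_addE L1fun_scaleE gx0 mulr0 addr0.
Qed.

(** A set carrying at most half of the norm of a right-symmetric [f] carries none of
    it: the restriction of [f] to such a set is orthogonal to [f], whereas
    subtracting it from [f] lowers the norm by [mass f B]. *)
Lemma right_symmetric_light_part f B : measurable B ->
  right_symmetric (toL1 f) -> mass f B <= mass f (~` B) -> mass f B = 0.
Proof.
move=> mB rs leB; pose g := L1restrict f B mB.
have mCB := measurableC mB.
have gB x : B x -> g x = f x by move=> Bx; rewrite /g /= mem_set.
have gCB x : (~` B) x -> g x = 0 by move=> Bx; rewrite /g /= memNset.
have /rs/BJ_orthogonal_massP/(_ (-1)) : BJ_orthogonal (toL1 g) (toL1 f).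
  apply/BJ_orthogonal_massP => a; rewrite !(mass_split _ _ mB).
  rewrite (mass_ae0 g (~` B))//; last exact: aeW.
  rewrite (eq_mass g f B)//; last exact: aeW.
  rewrite (eq_mass (g + a *: f) ((1 + a) *: f) B)//; last first.
    by apply: aeW => x /gB gx; rewrite L1fun_addE !L1fun_scaleE gx mulrDl mul1r.
  rewrite (eq_mass (g + a *: f) (a *: f) (~` B))//; last first.
    by apply: aeW => x /gCB gx; rewrite L1fun_addE !L1fun_scaleE gx add0r.
  rewrite !mass_scale// addr0.
  apply: (@le_trans _ _ ((modulus (1 + a) + modulus a) * mass f B)).
    rewrite ler_peMl ?mass_ge0// -(ler_of_real k) of_realD !of_real_modulus.
    (* [1 = (1 + a) - a]. *)
    have := ler_normB (1 + a) a; rewrite addrK normr1.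
    by have -> : of_real 1 = 1 :> K by case: (k).
  by rewrite mulrDl lerD2l ler_wpM2l// modulus_ge0.
rewrite !(mass_split _ _ mB) (mass_ae0 (f + _) B)//; last first.
  by apply: aeW => x /gB gx; rewrite L1fun_addE L1fun_scaleE gx mulN1r subrr.
rewrite (eq_mass (f + _) f (~` B))//; last first.
  by apply: aeW => x /gCB gx; rewrite L1fun_addE L1fun_scaleE gx mulr0 addr0.
by rewrite add0r gerDr => fB; apply/eqP; rewrite eq_le fB mass_ge0.
Qed.

Lemma right_symmetric_measure_atom f : toL1 f != 0 ->
  right_symmetric (toL1 f) -> measure_atom mu [set x | f x != 0].
Proof.
set A := [set x | f x != 0] => fN0 rs; have mA : measurable A := measurable_support f.
split => //.
  rewrite measure_gt0; apply: contraNN fN0 => /eqP/(null_set_aeP _ _ mA) A0.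
  rewrite (_ : 0 = toL1 0); last by rewrite /toL1 raddf0.
  apply/eqP/toL1_eqP; apply: filterS A0 => x /negP; rewrite negbK => /eqP.
  exact.
move=> B mB BA B0; apply/eqP; rewrite -measure_le0 leNgt; apply/negP => C0.
have fB := mass_gt0 f B mB B0 BA.
have [/(right_symmetric_light_part f B mB rs) fB0|/ltW] :=
    leP (mass f B) (mass f (~` B)).
  by move: fB; rewrite fB0 ltxx.
have mCB := measurableC mB.
rewrite -[X in _ <= mass f X]setCK => /(right_symmetric_light_part f _ mCB rs).
move=> /(mass_eq0 _ _ mCB) f0; move: C0; rewrite lt_neqAle eq_sym.
case/andP => /eqP + _; apply; apply/null_set_aeP; first exact: measurableD.
by apply: filterS f0 => x fx [/eqP Ax /fx].
Qed.

End mass.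

Theorem theorem3p0p5 (R : realType) (k : scalar_kind)
    (d : measure_display) (X : measurableType d)
    (lambda : {measure set X -> \bar R}) (f : L1fun lambda k) :
  toL1 f != 0 ->
  (right_symmetric (toL1 f) <-> measure_atom lambda [set x | f x != 0]).
Proof.
move=> fN0; split; first exact: right_symmetric_measure_atom.
exact: measure_atom_right_symmetric.
Qed.
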